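(* Let $R$ be an associative ring with identity and let $a,b\in R$. Suppose $\alpha:=1-ab$ is pseudo Drazin invertible with index $k$, pseudo Drazin inverse $\alpha^{pD}$ and strongly spectral idempotent $e:=1-\alpha^{pD}\alpha$, and let $u:=1-\alpha e$. Then $\beta:=1-ba$ is also pseudo Drazin invertible with index $k$, its pseudo Drazin inverse is $$\beta^{pD}=(1-beu^{-1}a)+b\alpha^{pD}a,$$ and the strongly spectral idempotent for $\beta$ is $beu^{-1}a$.
   Context: For $x\in R$, $comm(x)=\{y\in R\mid xy=yx\}$ and $comm^2(x)=\{y\in R\mid yz=zy\text{ for all }z\in comm(x)\}$. $J(R)$ is the Jacobson radical of $R$, and $J^{\#}(R)=\{x\in R\mid x^n\in J(R)\text{ for some positive integer }n\}$. An element $x\in R$ is pseudo Drazin invertible if there is $y\in R$ with $xy^2=y$, $y\in comm^2(x)$ and $x^2y-x\in J^{\#}(R)$. Such a $y$ is unique if it exists; it is called the pseudo Drazin inverse of $x$ and denoted $x^{pD}$. The strongly spectral idempotent of a pseudo Drazin invertible element $x$ is $1-x^{pD}x$, and its index is the least positive integer $k$ such that $x^k(1-x^{pD}x)\in J(R)$. The element $u=1-\alpha e$ is a unit of $R$ since $\alpha e\in J^{\#}(R)$, so $u^{-1}$ makes sense. *)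

(* Defs.v *)
From mathcomp Require Import all_boot all_algebra.
From mathcomp Require Import classical_sets.

Set Implicit Arguments.
Unset Strict Implicit.
Unset Printing Implicit Defensive.

Import GRing.Theory.
Local Open Scope ring_scope.
Local Open Scope classical_set_scope.

(* Closure under opposites is the case r = -1 of the last clause. *)
Definition left_ideal (R : pzRingType) (I : set R) : Prop :=
  [/\ I 0,
      forall x y, I x -> I y -> I (x + y)
    & forall r x, I x -> I (r * x)].

Definition maximal_left_ideal (R : pzRingType) (M : set R) : Prop :=
  [/\ left_ideal M,
      M <> setT
    & forall I, left_ideal I -> M `<=` I -> I = M \/ I = setT].

(* In the zero ring there is no maximal left ideal and this is setT. *)
Definition jacobson (R : pzRingType) : set R :=
  \bigcap_(M in @maximal_left_ideal R) M.

Definition jacobson_sharp (R : pzRingType) : set R :=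
  [set x | exists2 n : nat, (0 < n)%N & jacobson (x ^+ n)].

Definition comm1 (R : pzRingType) (x : R) : set R := [set y | GRing.comm x y].

Definition comm2 (R : pzRingType) (x : R) : set R :=
  [set y | forall z, comm1 x z -> GRing.comm y z].

(* For a given x, such a y is unique if it exists; it is written x^pD. *)
Definition pD_inverse (R : pzRingType) (x y : R) : Prop :=
  [/\ x * y ^+ 2 = y,
      comm2 x y
    & jacobson_sharp (x ^+ 2 * y - x)].

(* Meaningful only for y the pseudo Drazin inverse of x; likewise for pD_index. *)
Definition spectral_idempotent (R : pzRingType) (x y : R) : R := 1 - y * x.

Definition pD_index (R : pzRingType) (x y : R) (k : nat) : Prop :=
  [/\ (0 < k)%N,
      jacobson (x ^+ k * spectral_idempotent x y)
    & forall j : nat, (0 < j)%N ->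
        jacobson (x ^+ j * spectral_idempotent x y) -> (k <= j)%N].

(* Main.v *)
(** Write [f = b e u^-1 a].  Since [e u = e a b], the element [w = e u^-1]
    inverts [a b] on the corner cut out by [e]; hence [f] is an idempotent, and
    [beta b = b alpha] gives [beta ^ n f = b (alpha ^ n w) a].  As the Jacobson
    radical is a two-sided ideal, [beta ^ n f] lies in it exactly when
    [alpha ^ n e] does, which yields the quasinilpotence of [beta f] and the
    equality of the indices.  That [f] double-commutes with [beta] comes from
    the fact that [a z b] commutes with [a b] whenever [z] commutes with
    [b a]. *)
Require Import Defs.
From mathcomp Require Import all_boot all_algebra.
From mathcomp Require Import boolp classical_sets.

Set Implicit Arguments.
Unset Strict Implicit.
Unset Printing Implicit Defensive.

Import GRing.Theory.

Local Open Scope ring_scope.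
Local Open Scope classical_set_scope.

(** * Maximal left ideals, the Jacobson radical and units *)

(** Zorn's lemma applies because properness, put as the absence of [1], survives unions of
    chains. *)
Lemma left_ideal_ext_maximal (R : pzRingType) (I : set R) :
  left_ideal I -> ~ I 1 ->
  exists2 M : set R, maximal_left_ideal M & I `<=` M.
Proof.
move=> idI I1.
(* [set0] is allowed in the family because it is the union of the empty chain. *)
pose P (A : set R) := A = set0 \/ [/\ left_ideal A, I `<=` A & ~ A 1].
have chainP (F : set (set R)) :
    F `<=` P -> total_on F subset -> P (\bigcup_(X in F) X).
  move=> FP totF.
  have [[X FX [x Xx]]|F0] := pselect (exists2 X, F X & X !=set0); last first.
    left; apply/seteqP; split=> // x [X FX Xx].
    by case: F0; exists X => //; exists x.
  have good Y y : F Y -> Y y -> [/\ left_ideal Y, I `<=` Y & ~ Y 1].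
    by move=> FY Yy; case: (FP Y FY) => // Y0; rewrite Y0 in Yy.
  have [[X0 _ _] IX _] := good X x FX Xx.
  right; split; last 2 first.
  - by move=> y /IX Xy; exists X.
  - by move=> [Y FY Y1]; case: (good Y 1 FY Y1).
  split; first by exists X.
  - move=> y z [Y FY Yy] [Z FZ Zz].
    have [[_ YD _] _ _] := good Y y FY Yy.
    have [[_ ZD _] _ _] := good Z z FZ Zz.
    have [YZ|ZY] := totF Y Z FY FZ.
    + by exists Z => //; apply: ZD => //; apply: YZ.
    + by exists Y => //; apply: YD => //; apply: ZY.
  - move=> r y [Y FY Yy]; have [[_ _ YM] _ _] := good Y y FY Yy.
    by exists Y => //; apply: YM.
have [M [PM maxM]] := Zorn_bigcup chainP.
have PI : P I by right; split.
have [I0 _ _] := idI.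
(* The maximal member is not [set0]: the family also contains [I], which has [0] as an element. *)
have [idM IM M1] : [/\ left_ideal M, I `<=` M & ~ M 1].
  case: PM => // M0; case: (maxM I) => //; rewrite M0; split=> // /(_ 0 I0).
  by [].
exists M => //; split=> // [MT|A idA MA]; first by apply: M1; rewrite MT.
have [A1|A1] := pselect (A 1).
  right; apply/seteqP; split=> // x _.
  by have [_ _ AM] := idA; rewrite -[x]mulr1; apply: AM.
left; apply/seteqP; split=> //; apply: contrapT => AM.
case: (maxM A); first by split.
by right; split=> // x /IM /MA.
Qed.

(** If [1 - r x] has no left inverse, the left ideal it generates lies in a maximal one, which
    contains [x] too and hence [1]. Conversely, if [x] is outside a maximal [M], then [M + R x]
    contains [1], so some [1 - r x] lies in [M], and its left inverse forces [1] into [M]. *)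
Lemma jacobsonP (R : pzRingType) (x : R) :
  jacobson x <-> forall r, exists s, s * (1 - r * x) = 1.
Proof.
split=> [Jx r|Jx M [idM MT maxM]].
  apply: contrapT => noinv.
  pose I : set R := [set y | exists s, y = s * (1 - r * x)].
  have idI : left_ideal I.
    split; first by exists 0; rewrite mul0r.
    - by move=> _ _ [s ->] [t ->]; exists (s + t); rewrite mulrDl.
    - by move=> t _ [s ->]; exists (t * s); rewrite mulrA.
  have [|M maxM IM] := left_ideal_ext_maximal idI.
    by move=> [s Is]; apply: noinv; exists s.
  have Mx := Jx M maxM; have [[_ MD MM] MT _] := maxM.
  apply: MT; apply/seteqP; split=> // y _.
  rewrite -[y]mulr1; apply: (MM); rewrite -(subrK (r * x) 1).
  by apply: MD; [apply: IM; exists 1; rewrite mul1r | apply: MM].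
apply: contrapT => Mx; have [M0 MD MM] := idM.
pose I : set R := [set y | exists2 m, M m & exists r, y = m + r * x].
have idI : left_ideal I.
  split; first by exists 0 => //; exists 0; rewrite mul0r addr0.
  - move=> _ _ [m Mm [r ->]] [n Mn [t ->]]; exists (m + n); first exact: MD.
    by exists (r + t); rewrite mulrDl addrACA.
  - move=> t _ [m Mm [r ->]]; exists (t * m); first exact: MM.
    by exists (t * r); rewrite mulrDr mulrA.
have MI : M `<=` I by move=> m Mm; exists m => //; exists 0; rewrite mul0r addr0.
case: (maxM I idI MI) => [IM|IT].
  by apply: Mx; rewrite -IM; exists 0 => //; exists 1; rewrite mul1r add0r.
have [m Mm [r e1]] : I 1 by rewrite IT.
have [s s1] := Jx r; apply: MT; apply/seteqP; split=> // y _.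
by rewrite -[y]mulr1 -s1 mulrA; apply: MM; rewrite e1 addrK.
Qed.

Lemma jacobsonMl (R : pzRingType) (r x : R) : jacobson x -> jacobson (r * x).
Proof.
by move/jacobsonP=> Jx; apply/jacobsonP=> t; rewrite mulrA; apply: Jx.
Qed.

Lemma jacobsonMr (R : pzRingType) (x r : R) : jacobson x -> jacobson (x * r).
Proof.
move/jacobsonP=> Jx; apply/jacobsonP=> t; have [s s1] := Jx (r * t).
(* A left inverse of [1 - r t x] yields one of [1 - t x r]. *)
exists (1 + t * x * s * r).
have -> : (1 + t * x * s * r) * (1 - t * (x * r)) =
          1 - t * x * r + t * x * (s * (1 - r * t * x)) * r.
  by rewrite mulrDl mul1r !(mulrBr, mulrBl) !mulr1 !mulrA.
by rewrite s1 mulr1 subrK.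
Qed.

(** A left inverse [s] of [1 - x] equals [1 + s x], so it has a left inverse in turn and is
    therefore two-sided. *)
Lemma jacobson_subr1_unit (R : pzRingType) (x : R) :
  jacobson x -> exists s, s * (1 - x) = 1 /\ (1 - x) * s = 1.
Proof.
move/jacobsonP=> Jx; have [s] := Jx 1; rewrite mul1r => s1; exists s.
split=> //; have [t] := Jx (- s).
have -> : 1 - - s * x = s by rewrite mulNr opprK -{1}s1 mulrBr mulr1 subrK.
by move=> t1; rewrite -[1 - x]mul1r -{1}t1 -(mulrA t) s1 mulr1.
Qed.

(** The geometric sum [p] commutes with [1 - x], and their product [1 - x ^+ n] is a unit. *)
Lemma jacobson_sharp_subr1_unit (R : pzRingType) (x : R) :
  jacobson_sharp x -> exists s, (1 - x) * s = 1 /\ s * (1 - x) = 1.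
Proof.
move=> [n _ Jx]; have [s [sl sr]] := jacobson_subr1_unit Jx.
pose p := \sum_(i < n) x ^+ i.
have xp : (1 - x) * p = 1 - x ^+ n by rewrite -opprB mulNr -subrX1 opprB.
have px : p * (1 - x) = 1 - x ^+ n.
  rewrite -xp; apply/commr_sym/commr_sum => i _; apply/commrX/commr_sym.
  by apply: commrB; [apply: commr1 | apply: commr_refl].
have xps : (1 - x) * (p * s) = 1 by rewrite mulrA xp sr.
exists (p * s); split=> //.
(* [s p] is a left inverse of [1 - x] and [p s] a right one, so they agree. *)
suff -> : p * s = s * p by rewrite -mulrA px sl.
by rewrite -[RHS]mulr1 -xps !mulrA -(mulrA s p) px sl mul1r.
Qed.

Lemma jacobson_sharpN (R : pzRingType) (x : R) :
  jacobson_sharp (- x) -> jacobson_sharp x.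
Proof.
move=> [n n0 Jx]; exists n => //.
by rewrite -[x]opprK exprNn; apply: jacobsonMl.
Qed.

(** * Powers and commutants *)

Lemma exprM_idempotent (R : pzRingType) (x e : R) (n : nat) :
  e * e = e -> GRing.comm x e -> (0 < n)%N -> (x * e) ^+ n = x ^+ n * e.
Proof.
move=> ee xe; case: n => // n _; rewrite exprMn_comm //; congr (_ * _).
by elim: n => [|n IH]; rewrite ?expr1 // exprS IH.
Qed.

Lemma comm1_subr1 (R : pzRingType) (x z : R) :
  comm1 (1 - x) z <-> GRing.comm x z.
Proof.
split=> xz; apply: commr_sym.
  by rewrite -[x](subKr 1); apply: commrB; [apply: commr1|apply: commr_sym].
by apply: commrB; [apply: commr1|apply: commr_sym].
Qed.

Lemma commr_inv (R : pzRingType) (u v z : R) :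
  u * v = 1 -> v * u = 1 -> GRing.comm u z -> GRing.comm v z.
Proof.
move=> uv vu uz; rewrite /GRing.comm.
by rewrite -[LHS]mulr1 -uv !mulrA -(mulrA v z u) -uz (mulrA v) vu mul1r.
Qed.

Lemma comm1_swap (R : pzRingType) (a b z : R) :
  comm1 (1 - b * a) z -> comm1 (1 - a * b) (a * z * b).
Proof.
move/comm1_subr1=> baz; apply/comm1_subr1; rewrite /GRing.comm.
by rewrite -!mulrA; congr (a * _); rewrite !mulrA baz !mulrA.
Qed.

(** With [c = a b], [w = w^2 c = c w^2]. The extra factor [c] turns [b w a z] into
    [b w^2 (a z b) a], where [w] commutes with [a z b]; the same computation mirrored gives
    [z b w a]. *)
Lemma comm2_swap (R : pzRingType) (a b w : R) :
  w * (a * b) * w = w -> comm2 (1 - a * b) w ->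
  comm2 (1 - b * a) (b * w * a).
Proof.
move=> wcw w2 z z1; have /comm1_subr1 baz := z1.
have wz := w2 _ (comm1_swap z1).
have wc : GRing.comm w (a * b) by apply/w2/comm1_subr1.
have wl : w = a * b * (w * w) by rewrite mulrA -wc wcw.
have wr : w = w * w * (a * b) by rewrite -mulrA wc mulrA wcw.
have wwz : w * w * (a * z * b) = a * z * b * (w * w).
  by rewrite -mulrA wz mulrA wz mulrA.
rewrite /GRing.comm; transitivity (b * (w * w * (a * z * b)) * a).
  by rewrite {1}wr -!mulrA -baz -!mulrA.
by rewrite wwz {3}wl !mulrA baz !mulrA.
Qed.

(** * Pseudo Drazin inverses described by idempotents *)

Lemma spectral_idempotentP (R : pzRingType) (x y : R) :
  pD_inverse x y -> let e := spectral_idempotent x y in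
  [/\ comm2 x e, e * e = e, y * e = 0, e * y = 0 & jacobson_sharp (x * e)].
Proof.
rewrite /spectral_idempotent => -[xyy y2 Jxy] /=.
have yx : y * x = x * y by apply/y2/commr_refl.
have ye : y * (1 - y * x) = 0.
  by rewrite mulrBr mulr1 yx mulrA yx -mulrA -expr2 xyy subrr.
have ey : (1 - y * x) * y = 0.
  by rewrite mulrBl mul1r yx -mulrA -expr2 xyy subrr.
split=> //.
- move=> z xz; apply/commr_sym/commrB; first exact: commr1.
  by apply: commrM; apply/commr_sym => //; apply: y2.
- by rewrite {1}mulrBr mulr1 mulrA ey mul0r subr0.
- apply: jacobson_sharpN.
  by rewrite -mulrN opprB mulrBr mulr1 yx mulrA.
Qed.

(** A converse to [spectral_idempotentP]: [y] inverts [x] on the corner of [1 - f] and vanishes on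
    that of [f], so it inherits double commutation from [f]. *)
Lemma pD_inverse_of_idempotent (R : pzRingType) (x y f : R) :
  comm2 x f -> y * f = 0 -> f * y = 0 -> y * x = 1 - f -> x * y = 1 - f ->
  jacobson_sharp (- (x * f)) -> pD_inverse x y.
Proof.
move=> f2 yf fy yx xy Jf; split.
- by rewrite expr2 mulrA xy mulrBl mul1r fy subr0.
- move=> z xz; have fz := f2 z xz.
  (* [y z f = y f z = 0], so [y z = y z (1 - f)], and [1 - f = x y]. *)
  have yzxy : y * z = y * (z * x) * y.
    by rewrite -!mulrA xy mulrBr mulr1 mulrBr -fz (mulrA y f) yf mul0r subr0.
  rewrite /GRing.comm yzxy -xz mulrA yx mulrBl mul1r fz mulrBl -!mulrA fy.
  by rewrite mulr0 subr0.
- suff -> : x ^+ 2 * y - x = - (x * f) by [].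
  by rewrite expr2 -mulrA xy mulrBr mulr1 addrC addKr.
Qed.

Lemma exp_subr1_swap (R : pzRingType) (a b : R) (n : nat) :
  (1 - b * a) ^+ n * b = b * (1 - a * b) ^+ n.
Proof.
have swap : (1 - b * a) * b = b * (1 - a * b).
  by rewrite mulrBl mul1r mulrBr mulr1 mulrA.
elim: n => [|n IH]; first by rewrite !expr0 mul1r mulr1.
by rewrite !exprSr -mulrA swap mulrA IH mulrA.
Qed.

Lemma jacobson_corner_swap (R : pzRingType) (a b e w : R) (n : nat) :
  w * (a * b) = e -> a * b * w = e -> e * w = w -> e * e = e ->
  jacobson ((1 - b * a) ^+ n * (b * w * a)) <->
  jacobson ((1 - a * b) ^+ n * e).
Proof.
move=> wc cw ew ee.
have -> : (1 - b * a) ^+ n * (b * w * a) = b * ((1 - a * b) ^+ n * w) * a.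
  by rewrite !mulrA exp_subr1_swap.
split=> [Jb|Je].
  (* To undo the passage from [a b] to [b a], multiply by [a] on the left and by [b w] on the right:
     each side then supplies a factor [a b], and [a b w = e]. *)
  have -> : (1 - a * b) ^+ n * e =
            a * (b * ((1 - a * b) ^+ n * w) * a) * (b * w).
    rewrite !mulrA.
    have -> : a * b * (1 - a * b) ^+ n = (1 - a * b) ^+ n * (a * b).
      apply/commrX/commrB; [exact: commr1|exact: commr_refl].
    by rewrite -!mulrA (mulrA a b w) cw (mulrA a b) (mulrA (a * b)) cw ee.
  by apply: jacobsonMr; apply: jacobsonMl.
rewrite -ew (mulrA (_ ^+ n)).
by apply: jacobsonMr; apply: jacobsonMl; apply: jacobsonMr.
Qed.

Theorem theorem3p4 (R : pzRingType) (a b alphaD : R) (k : nat) :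
  let alpha := 1 - a * b in
  let beta := 1 - b * a in
  let e := spectral_idempotent alpha alphaD in
  let u := 1 - alpha * e in
  pD_inverse alpha alphaD ->
  pD_index alpha alphaD k ->
  exists2 uinv : R, (u * uinv = 1 /\ uinv * u = 1) &
    let betaD := (1 - b * e * uinv * a) + b * alphaD * a in
    [/\ pD_inverse beta betaD,
        pD_index beta betaD k
      & spectral_idempotent beta betaD = b * e * uinv * a].
Proof.
move=> alpha beta e u pDa [k0 Jk kmin].
have [e2 ee ye ey Jae] := spectral_idempotentP pDa.
rewrite -/e in e2 ee ye ey Jae.
have [_ y2 _] := pDa.
have [v [uv vu]] := jacobson_sharp_subr1_unit Jae; rewrite -/u in uv vu.
exists v => // betaD.
have alphay : alpha * alphaD = alphaD * alpha by apply/commr_sym/y2/commr_refl.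
have ec : e * (a * b) = a * b * e by apply: e2; apply/comm1_subr1.
have alphae : alpha * e = e * alpha by apply/commr_sym/e2/commr_refl.
have alphaE : alpha = 1 - a * b by [].
have u2 : comm2 alpha u.
  move=> z az; apply/commr_sym/commrB; first exact: commr1.
  by apply: commrM; apply: commr_sym; [|exact: e2].
have v2 : comm2 alpha v by move=> z /u2; apply: commr_inv.
pose w := e * v.
have w2 : comm2 alpha w.
  move=> z az; apply: commr_sym.
  by apply: commrM; apply: commr_sym; [exact: e2|exact: v2].
have ew : e * w = w by rewrite /w mulrA ee.
have eu : e * u = e * (a * b).
  by rewrite /u mulrBr mulr1 alphae mulrA ee alphaE mulrBr mulr1 subKr.
have cw : a * b * w = e by rewrite /w mulrA -ec -eu -mulrA uv mulr1.
have wc : w * (a * b) = e by rewrite -cw; apply/w2/comm1_subr1.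
pose f := b * w * a.
have fE : b * e * v * a = f by rewrite /f /w !mulrA.
have f2 : comm2 beta f by apply: comm2_swap => //; rewrite wc.
have ff : f * f = f.
  have -> : f * f = b * (w * (a * b) * w) * a by rewrite /f !mulrA.
  by rewrite wc ew.
have betab : beta * b = b * alpha.
  by have := exp_subr1_swap a b 1; rewrite !expr1.
have abeta : a * beta = alpha * a.
  by rewrite /beta mulrBr mulr1 /alpha mulrBl mul1r mulrA.
have yE : alphaD * alpha = 1 - e by rewrite /e /spectral_idempotent subKr.
have betaf : f * beta = beta * f by apply/f2/commr_refl.
have betafE : beta * f = b * (alpha * w) * a by rewrite /f !mulrA betab.
have uwE : alpha * w + e = w by rewrite -cw -mulrDl subrK mul1r.
(* Both [betaD * beta] and [beta * betaD] expand to this sum. Its value follows from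
   [beta + b a = 1] and [beta f + b e a = b (alpha w + e) a = f]. *)
have sumE : (beta - beta * f) + b * (1 - e) * a = 1 - f.
  have abel (c p q : R) : 1 - c - p + (c - q) = 1 - (p + q).
    by rewrite opprD !addrA (addrAC _ (- p)) subrK.
  rewrite (mulrBr b 1 e) mulr1 (mulrBl a b) abel; congr (_ - _).
  by rewrite betafE -mulrDl -mulrDr uwE.
have bDb : betaD * beta = 1 - f.
  rewrite -sumE mulrDl fE (mulrBl beta 1 f) mul1r betaf -yE.
  by rewrite -(mulrA _ a beta) abeta !mulrA.
have bbD : beta * betaD = 1 - f.
  rewrite -sumE mulrDr fE (mulrBr beta 1 f) mulr1 -yE -alphay.
  by rewrite !mulrA betab.
(* Idempotence of [f] kills the summand [1 - f] of [betaD]; [alphaD * e = 0] kills the other. *)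
have bDf : betaD * f = 0.
  rewrite /betaD fE mulrDl mulrBl mul1r ff subrr add0r.
  have -> : b * alphaD * a * f = b * (alphaD * (a * b * w)) * a.
    by rewrite /f !mulrA.
  by rewrite cw ye mulr0 mul0r.
have fbD : f * betaD = 0.
  rewrite /betaD fE mulrDr mulrBr mulr1 ff subrr add0r.
  have -> : f * (b * alphaD * a) = b * (w * (a * b) * alphaD) * a.
    by rewrite /f !mulrA.
  by rewrite wc ey mulr0 mul0r.
have spE : spectral_idempotent beta betaD = f.
  by rewrite /spectral_idempotent bDb subKr.
have JE n := jacobson_corner_swap n wc cw ew ee.
split; last by rewrite spE fE.
- apply: (pD_inverse_of_idempotent f2) => //.
  (* The index itself is the exponent: as [0 < k], [(beta f)^k = beta^k f], and the sign is absorbed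
     by the radical. *)
  exists k => //; rewrite exprNn; apply: jacobsonMl.
  rewrite exprM_idempotent //; exact/JE.
- split=> //; first by rewrite spE; apply/JE.
  by move=> j j0; rewrite spE => /JE; apply: kmin.
Qed.
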